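(* Let $\alpha_0,\alpha_1,\alpha_2$ be complex parameters with $\alpha_0+\alpha_1+\alpha_2=\frac12$, and consider the system $$\begin{aligned} \frac{dq_1}{dt}&=2q_1^2+4p_1+2t+4p_2,\\ \frac{dp_1}{dt}&=-4q_1p_1+2q_2p_2-2\alpha_0,\\ \frac{dq_2}{dt}&=q_2^2-4p_2+4p_1-2q_1q_2,\\ \frac{dp_2}{dt}&=-2q_2p_2+2q_1p_2-\alpha_1. \end{aligned}$$ This system has the following invariant divisors: (i) if $\alpha_0=0$, then $f_0:=p_1+\frac{q_2^2}{4}$ is an invariant divisor; (ii) if $\alpha_1=0$, then $f_1:=p_2$ is an invariant divisor; (iii) if $\alpha_2=0$, then $f_2:=p_1+2p_2+t+q_1q_2-\frac{q_2^2}{4}$ is an invariant divisor.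
   Context: A polynomial $f\in\mathbb{C}(t)[q_1,p_1,q_2,p_2]$ is an invariant divisor of the system if its total derivative $\frac{df}{dt}$ along the system (i.e. $\frac{\partial f}{\partial t}$ plus the derivative of $f$ along the vector field given by the right-hand sides) is divisible by $f$ in $\mathbb{C}(t)[q_1,p_1,q_2,p_2]$; thus the locus $f=0$ is preserved by the flow. *)

(* Defs.v *)
From HB Require Import structures.
From mathcomp Require Import all_boot all_order all_algebra.
From mathcomp Require Import generic_quotient.
From mathcomp Require Import ring.
From mathcomp Require Import reals complex mpoly.

Set Implicit Arguments.
Unset Strict Implicit.
Unset Printing Implicit Defensive.

Import GRing.Theory.
Local Open Scope ring_scope.
Local Open Scope quotient_scope.

Notation "x %:F" := (FracField.tofrac x).

Section InvariantDivisor.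
Variable F : fieldType.

(* d/dt on F(t) by the quotient rule.  It reads the representative of x chosen
   by the quotient; fracderiv_div shows that the choice is immaterial. *)
Definition fracderiv (x : {fraction {poly F}}) : {fraction {poly F}} :=
  let: (n, d) := (\n_(repr x), \d_(repr x)) in
  (n^`() * d - n * d^`())%:F / (d ^+ 2)%:F.

Lemma frac_repr (x : {fraction {poly F}}) :
  x = (\n_(repr x))%:F / (\d_(repr x))%:F.
Proof.
have d0 := denom_ratioP (repr x).
apply: (mulIf (x := (\d_(repr x))%:F)); first by rewrite tofrac_eq0.
rewrite mulfVK ?tofrac_eq0 // -{1}[x]reprK.
set y := repr x in d0 *.
unlock FracField.tofrac; rewrite -[LHS]FracField.pi_mul; apply/eqmodP => /=.
rewrite FracField.equivfE /FracField.mulf /= !numden_Ratio ?oner_neq0 ?mulf_neq0 ?oner_neq0 //.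
by rewrite !mulr1 mulrC.
Qed.

Lemma fracderiv_div (n d : {poly F}) : d != 0 ->
  fracderiv (n%:F / d%:F) = (n^`() * d - n * d^`())%:F / (d ^+ 2)%:F.
Proof.
move=> d0; rewrite /fracderiv.
set x := n%:F / d%:F; have e0 := denom_ratioP (repr x).
have := frac_repr x; rewrite {1}/x.
move: (\n_(repr x)) (\d_(repr x)) e0 => m e e0 /eqP.
rewrite eqr_div ?tofrac_eq0 // -!tofracM tofrac_eq => /eqP nemd.
apply/eqP; rewrite eqr_div ?tofrac_eq0 ?expf_neq0 // -!tofracM tofrac_eq.
have dnemd := congr1 (@deriv F) nemd; rewrite !derivM in dnemd.
apply/eqP; move: (n^`()) (d^`()) (m^`()) (e^`()) dnemd => n' d' m' e' dnemd.
have ->: (m' * e - m * e') * d ^+ 2 =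
   d * e * (m' * d + m * d') - d * e' * (m * d) - e * d' * (m * d) by ring.
by rewrite -dnemd -nemd; ring.
Qed.

Lemma fracderivD : {morph fracderiv : x y / x + y}.
Proof.
move=> x y; rewrite (frac_repr x) (frac_repr y).
have := denom_ratioP (repr x); have := denom_ratioP (repr y).
move: (\n_(repr x)) (\d_(repr x)) (\n_(repr y)) (\d_(repr y)) => n d m e e0 d0.
rewrite addf_div ?tofrac_eq0 // -!tofracM -tofracD.
rewrite !fracderiv_div ?mulf_neq0 // addf_div ?tofrac_eq0 ?expf_neq0 //.
rewrite -!tofracM -tofracD; apply/eqP.
rewrite eqr_div ?tofrac_eq0 ?mulf_neq0 ?expf_neq0 // -!tofracM tofrac_eq.
by rewrite derivD !derivM; apply/eqP; ring.
Qed.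

Lemma fracderivM x y : fracderiv (x * y) = fracderiv x * y + x * fracderiv y.
Proof.
rewrite (frac_repr x) (frac_repr y).
have := denom_ratioP (repr x); have := denom_ratioP (repr y).
move: (\n_(repr x)) (\d_(repr x)) (\n_(repr y)) (\d_(repr y)) => n d m e e0 d0.
rewrite mulf_div -!tofracM !fracderiv_div ?mulf_neq0 // !mulf_div -!tofracM.
rewrite addf_div ?tofrac_eq0 ?mulf_neq0 ?expf_neq0 //.
rewrite -!tofracM -tofracD; apply/eqP.
rewrite eqr_div ?tofrac_eq0 ?mulf_neq0 ?expf_neq0 // -!tofracM tofrac_eq.
by rewrite !derivM; apply/eqP; ring.
Qed.

Lemma fracderiv_tofrac (p : {poly F}) : fracderiv p%:F = p^`()%:F.
Proof.
rewrite -[p%:F]divr1 -tofrac1 fracderiv_div ?oner_neq0 //.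
by rewrite derivC mulr0 subr0 mulr1 expr1n tofrac1 divr1.
Qed.

Variable n : nat.
Implicit Types f : {mpoly {fraction {poly F}}[n]}.

(* Partial derivative in t: fracderiv on every coefficient. *)
Definition tderiv f : {mpoly {fraction {poly F}}[n]} :=
  \sum_(m <- msupp f) fracderiv f@_m *: 'X_[m].

Lemma mcoeff_tderiv f m : (tderiv f)@_m = fracderiv f@_m.
Proof.
have fracderiv0 : fracderiv 0 = 0 :> {fraction {poly F}}.
  by rewrite -tofrac0 fracderiv_tofrac derivC.
rewrite /tderiv raddf_sum /=.
have [fm|fm] := boolP (m \in msupp f).
  rewrite (bigD1_seq m) ?msupp_uniq //= mcoeffZ mcoeffX eqxx mulr1.
  by rewrite big1 ?addr0 // => k /negPf km; rewrite mcoeffZ mcoeffX km mulr0.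
rewrite (memN_msupp_eq0 fm) fracderiv0 big_seq big1 // => k kf.
rewrite mcoeffZ mcoeffX; case: eqP => [km|_]; last by rewrite mulr0.
by rewrite km (negPf fm) in kf.
Qed.

(* v i is the right-hand side of the equation for the i-th unknown. *)
Definition total_deriv (v : 'I_n -> {mpoly {fraction {poly F}}[n]}) f :=
  tderiv f + \sum_(i < n) v i * f^`M(i).

Definition invariant_divisor v f := exists g, total_deriv v f = g * f.

End InvariantDivisor.

Section System.
Variable F : fieldType.
Local Notation phase_ring := {mpoly {fraction {poly F}}[4]}.

Definition cst (a : F) : phase_ring := (a%:P%:F)%:MP.
Definition t : phase_ring := ('X%:F)%:MP.
Definition q1 : phase_ring := 'X_(inord 0).
Definition p1 : phase_ring := 'X_(inord 1).
Definition q2 : phase_ring := 'X_(inord 2).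
Definition p2 : phase_ring := 'X_(inord 3).

Definition system (a0 a1 : F) (i : 'I_4) : phase_ring :=
  tnth [tuple
    2 * q1 ^+ 2 + 4 * p1 + 2 * t + 4 * p2;
    - 4 * q1 * p1 + 2 * q2 * p2 - 2 * cst a0;
    q2 ^+ 2 - 4 * p2 + 4 * p1 - 2 * q1 * q2;
    - 2 * q2 * p2 + 2 * q1 * p2 - cst a1] i.

End System.
Arguments t {F}.
Arguments q1 {F}.
Arguments p1 {F}.
Arguments q2 {F}.
Arguments p2 {F}.

(* Main.v *)
Require Import Defs.
From HB Require Import structures.
From mathcomp Require Import all_boot all_order all_algebra.
From mathcomp Require Import ring.
From mathcomp Require Import reals complex mpoly.

Import GRing.Theory Num.Theory.
Local Open Scope ring_scope.

(** The total derivative along a vector field is a derivation of the polynomial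
    ring over the rational functions of [t]: the product rule holds for
    differentiation of the coefficients ([tderivM]) because it does for rational
    functions, and it holds for the partial derivatives in the unknowns
    ([total_derivM]).  A derivation is determined by its values on constants,
    on [t] and on the unknowns, so the derivative of each candidate can be read
    off the system.  What remains is to exhibit the cofactors, where [f'] is
    the total derivative:
      - [f0' = (2 q2 - 4 q1) f0 - 2 alpha0];
      - [f1' = (2 q1 - 2 q2) f1 - alpha1];
      - [f2' = 2 q2 f2 + 1 - 2 alpha0 - 2 alpha1], and the normalisation of the
        parameters turns the constant term into [2 alpha2].
    The constant term vanishes exactly under the condition of each case. *)

Section Derivation.
Variables (F : fieldType) (n : nat).
Local Notation K := {fraction {poly F}}.
Implicit Types f g : {mpoly K[n]}.

Lemma fracderiv_is_zmod_morphism : zmod_morphism (@fracderiv F).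
Proof.
move=> x y; apply: (addIr (fracderiv y)).
by rewrite -fracderivD !subrK.
Qed.
HB.instance Definition _ :=
  GRing.isZmodMorphism.Build K K (@fracderiv F) fracderiv_is_zmod_morphism.

Lemma fracderiv_nat k : fracderiv (k%:R : K) = 0.
Proof. by rewrite -tofrac1 raddfMn /= fracderiv_tofrac derivC tofrac0 mul0rn. Qed.

Lemma tderiv_is_zmod_morphism : zmod_morphism (@tderiv F n).
Proof.
by move=> f g; apply/mpolyP => m; rewrite mcoeffB !mcoeff_tderiv mcoeffB raddfB.
Qed.
HB.instance Definition _ :=
  GRing.isZmodMorphism.Build {mpoly K[n]} {mpoly K[n]} (@tderiv F n)
    tderiv_is_zmod_morphism.

(** Each coefficient of a product is a sum of products of coefficients, so
    this is the product rule for rational functions summed over the ways of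
    splitting a monomial. *)
Lemma tderivM f g : tderiv (f * g) = tderiv f * g + f * tderiv g.
Proof.
apply/mpolyP => m; rewrite mcoeff_tderiv mcoeffD !mcoeffM raddf_sum /=.
rewrite -big_split /=; apply: eq_bigr => k _.
by rewrite fracderivM !mcoeff_tderiv.
Qed.

Lemma tderivC (c : K) : tderiv (c%:MP_[n]) = (fracderiv c)%:MP.
Proof.
apply/mpolyP => m; rewrite mcoeff_tderiv !mcoeffC.
by case: eqP => _; rewrite ?mulr1 // !mulr0 raddf0.
Qed.

Lemma tderivX (m : 'X_{1.. n}) : tderiv ('X_[m] : {mpoly K[n]}) = 0.
Proof. by apply/mpolyP => k; rewrite mcoeff_tderiv mcoeffX fracderiv_nat mcoeff0. Qed.

Variable v : 'I_n -> {mpoly K[n]}.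

Lemma total_deriv_is_zmod_morphism : zmod_morphism (total_deriv v).
Proof.
move=> f g; rewrite /total_deriv raddfB opprD addrACA -sumrB /=.
by congr (_ + _); apply: eq_bigr => i _; rewrite raddfB mulrBr.
Qed.
HB.instance Definition _ :=
  GRing.isZmodMorphism.Build {mpoly K[n]} {mpoly K[n]} (total_deriv v)
    total_deriv_is_zmod_morphism.

Lemma total_derivM f g :
  total_deriv v (f * g) = total_deriv v f * g + f * total_deriv v g.
Proof.
rewrite /total_deriv tderivM mulrDl mulrDr addrACA; congr (_ + _).
rewrite mulr_suml mulr_sumr -big_split /=; apply: eq_bigr => i _.
by rewrite mderivM; ring.
Qed.

Lemma total_derivC (c : K) : total_deriv v c%:MP = (fracderiv c)%:MP.
Proof.
by rewrite /total_deriv tderivC big1 ?addr0 // => i _; rewrite mderivC mulr0.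
Qed.

Lemma total_deriv_nat k : total_deriv v k%:R = 0.
Proof. by rewrite -mpolyC_nat total_derivC fracderiv_nat mpolyC0. Qed.

Lemma total_derivX i : total_deriv v 'X_i = v i.
Proof.
rewrite /total_deriv tderivX add0r (bigD1 i) //= big1 => [|j ji].
  rewrite mderivX mnm1E eqxx -{1}[U_(i)%MM]add0m addmK mpolyX0 scale1r.
  by rewrite mulr1 addr0.
by rewrite mderivX mnm1E eq_sym (negPf ji) scale0r mulr0.
Qed.

End Derivation.

(** Once the multiplier [k] is known, an identity that holds only modulo
    [r = 0] becomes an unconditional one, decidable by [ring]; here [r = 0]
    is the relation that defines the constant [1 / 4]. *)
Lemma eq_mod_relation (A : pzRingType) (r k x y : A) :
  r = 0 -> x - y = r * k -> x = y.
Proof. by move=> -> /eqP; rewrite mul0r subr_eq0 => /eqP. Qed.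

Section SystemDerivative.
Variables (F : fieldType) (a0 a1 : F).
Local Notation D := (total_deriv (system a0 a1)).

Lemma cst_is_zmod_morphism : zmod_morphism (@cst F).
Proof. by move=> a b; rewrite /cst !raddfB. Qed.
HB.instance Definition _ :=
  GRing.isZmodMorphism.Build F {mpoly {fraction {poly F}}[4]} (@cst F)
    cst_is_zmod_morphism.

Lemma cst1 : cst (1 : F) = 1.
Proof. by rewrite /cst !rmorph1. Qed.

Lemma cst0 : cst (0 : F) = 0.
Proof. exact: raddf0. Qed.

Lemma cst_divK (a : F) k : k%:R != 0 :> F -> k%:R * cst (a / k%:R) = cst a.
Proof.
move=> k0.
by rewrite mulr_natl -(raddfMn (@cst F)) -(mulr_natr (a / _)) divfK.
Qed.

Lemma D_cst a : D (cst a) = 0.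
Proof. by rewrite total_derivC fracderiv_tofrac derivC !raddf0. Qed.

Lemma D_t : D t = 1.
Proof. by rewrite total_derivC fracderiv_tofrac derivX !rmorph1. Qed.

Lemma D_q1 : D q1 = 2 * q1 ^+ 2 + 4 * p1 + 2 * t + 4 * p2.
Proof. by rewrite total_derivX /system (tnth_nth 0) inordK. Qed.

Lemma D_p1 : D p1 = - 4 * q1 * p1 + 2 * q2 * p2 - 2 * cst a0.
Proof. by rewrite total_derivX /system (tnth_nth 0) inordK. Qed.

Lemma D_q2 : D q2 = q2 ^+ 2 - 4 * p2 + 4 * p1 - 2 * q1 * q2.
Proof. by rewrite total_derivX /system (tnth_nth 0) inordK. Qed.

Lemma D_p2 : D p2 = - 2 * q2 * p2 + 2 * q1 * p2 - cst a1.
Proof. by rewrite total_derivX /system (tnth_nth 0) inordK. Qed.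

Lemma quarter_rel : 4%:R != 0 :> F -> 4 * cst (1 / 4 : F) - 1 = 0.
Proof. by move=> four0; rewrite (cst_divK _ _ four0) cst1 subrr. Qed.

Lemma total_deriv_f0 : 4%:R != 0 :> F ->
  D (p1 + cst (1 / 4) * q2 ^+ 2) =
  (2 * q2 - 4 * q1) * (p1 + cst (1 / 4) * q2 ^+ 2) - 2 * cst a0.
Proof.
move=> /quarter_rel; rewrite raddfD expr2 /= !total_derivM D_cst D_p1 D_q2.
move: (cst (1 / 4)) (cst a0) => c a c4.
(* The quarter [c] is an atom for [ring], and the two sides agree modulo
   [4 * c = 1] only.  Their difference is [(4 * c - 1) * k] with [k] free of
   [c], so [k] is minus the value of the difference at [c = 0]. *)
by apply: (eq_mod_relation _ _ (2 * q2 * p1 - 2 * q2 * p2) _ _ c4); ring.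
Qed.

Lemma total_deriv_f1 : D p2 = (2 * q1 - 2 * q2) * p2 - cst a1.
Proof. by rewrite D_p2; ring. Qed.

Lemma total_deriv_f2 : 4%:R != 0 :> F ->
  D (p1 + 2 * p2 + t + q1 * q2 - cst (1 / 4) * q2 ^+ 2) =
  2 * q2 * (p1 + 2 * p2 + t + q1 * q2 - cst (1 / 4) * q2 ^+ 2)
  + (1 - 2 * (cst a0 + cst a1)).
Proof.
move=> /quarter_rel.
rewrite expr2 raddfB 3!raddfD /= !total_derivM total_deriv_nat.
rewrite D_cst D_t D_p1 D_p2 D_q1 D_q2.
move: (cst (1 / 4)) (cst a0) (cst a1) => c a b c4.
(* The multiplier is found as in [total_deriv_f0]. *)
apply: (eq_mod_relation _ _
  (2 * q2 * p2 - 2 * q2 * p1 + q1 * q2 ^+ 2) _ _ c4).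
ring.
Qed.

Lemma cst_half_sum : 2%:R != 0 :> F -> a0 + a1 = 1 / 2 ->
  2 * (cst a0 + cst a1) = 1.
Proof.
move=> two0 half; have -> : cst a0 + cst a1 = cst (1 / 2).
  by rewrite -half raddfD.
by rewrite (cst_divK _ _ two0) cst1.
Qed.

End SystemDerivative.

Theorem proposition2p2 (R : realType) (alpha0 alpha1 alpha2 : R[i])
    (halpha : alpha0 + alpha1 + alpha2 = 1 / 2) :
  (alpha0 = 0 ->
     invariant_divisor (system alpha0 alpha1)
       (p1 + cst (1 / 4) * q2 ^+ 2)) /\
  (alpha1 = 0 ->
     invariant_divisor (system alpha0 alpha1) p2) /\
  (alpha2 = 0 ->
     invariant_divisor (system alpha0 alpha1)
       (p1 + 2 * p2 + t + q1 * q2 - cst (1 / 4) * q2 ^+ 2)).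
Proof.
have nat0 k : k.+1%:R != 0 :> R[i] by rewrite pnatr_eq0.
split; [|split] => h.
- exists (2 * q2 - 4 * q1).
  by rewrite (total_deriv_f0 _ _ _ (nat0 3)) h cst0 mulr0 subr0.
- exists (2 * q1 - 2 * q2).
  by rewrite total_deriv_f1 h cst0 subr0.
- exists (2 * q2).
  have half : alpha0 + alpha1 = 1 / 2 by rewrite -halpha h addr0.
  rewrite (total_deriv_f2 _ _ _ (nat0 3)).
  by rewrite (cst_half_sum _ _ _ (nat0 1) half) subrr addr0.
Qed.
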